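(* For every integer $n\ge 0$ let $$S_n=\frac{\binom{6n}{3n}\binom{3n}{n}}{2(2n+1)\binom{2n}{n}}$$ (so $S_0=\tfrac12$). Then there exist positive integers $T_1,T_2,\ldots$ such that $$\sum_{k=0}^\infty S_k x^{2k+1}+\frac{1}{24}-\sum_{k=1}^{\infty}T_k x^{2k}=\frac{\cos\!\big(\tfrac{2}{3}\arccos(6\sqrt{3}\,x)\big)}{12}$$ for all real $x$ with $|x|\le \frac{1}{6\sqrt{3}}$. Moreover, $T_p\equiv -2 \pmod p$ for every prime $p$.
   Context: $\arccos$ denotes the principal branch with values in $[0,\pi]$. *)

(* Defs.v *)
From Stdlib Require Import Reals ZArith Znumtheory.
From Coquelicot Require Import Coquelicot.
Open Scope R_scope.

(* [Binomial.C] is qualified because Coquelicot uses [C] for the type of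
   complex numbers. *)
Definition Sseq (n : nat) : R :=
  Binomial.C (6 * n) (3 * n) * Binomial.C (3 * n) n
  / (2 * (2 * INR n + 1) * Binomial.C (2 * n) n).

(* Main.v *)
(** With y = 6 sqrt 3 x = sin t the right-hand side is
    (cos (2t/3) / 2 + (sqrt 3 / 2) sin (2t/3)) / 12, whose two summands are the
    even and the odd part in y.  A power series P with the Chebyshev recurrence
    (n+2)(n+1) a_{n+2} = (n^2 - al^2) a_n satisfies
    (1 - y^2) P'' - y P' + al^2 P = 0, so that P (sin t) solves
    h'' = - al^2 h and is a combination of cos (al t) and sin (al t).  At the
    endpoints all terms have one sign, so the sums extend by monotonicity.
    Comparing ratios of consecutive coefficients gives
    T_k = 2 * 16^(k-1) (3k-2)! / ((k-1)! (2k)!)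
        = 16^(k-1) (C(3k-2, 2k-1) - 2 C(3k-2, 2k)).
    Modulo p the first binomial of T_p vanishes, as it is p times an integer,
    the second is 1, and Fermat removes the power of 16. *)

Require Import Defs.
From Stdlib Require Import Reals ZArith Znumtheory Lra Lia.
From Coquelicot Require Import Coquelicot.
From mathcomp Require ssreflect ssrfun ssrbool eqtype ssrnat div fintype bigop.
From mathcomp Require prime binomial zify.
Open Scope R_scope.

(** * The integers [T k]: positivity, recurrence and residue modulo a prime *)

(* A module, so that MathComp's [nat] notations do not reach the theorem. *)
Module Coefficients.
Import ssreflect ssrfun ssrbool eqtype ssrnat div fintype bigop prime binomial zify.
Local Open Scope nat_scope.

(* [W j] is [T (j + 1) / 16 ^ j]; the truncated subtraction is exact by [W_binom]. *)
Definition W (j : nat) : nat :=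
  'C(3 * j + 1, 2 * j + 1) - 2 * 'C(3 * j + 1, 2 * j + 2).

(** Consecutive binomials satisfy (2j+2) C(3j+1, 2j+2) = j C(3j+1, 2j+1), so j+1 times the
    difference leaves (j+1) - j copies of the first one. *)
Lemma W_binom (j : nat) : j.+1 * W j = 'C(3 * j + 1, 2 * j + 1).
Proof.
have := mul_bin_left (3 * j + 1) (2 * j + 1).
rewrite /W (_ : (2 * j + 1).+1 = 2 * j + 2); last lia.
rewrite (_ : 3 * j + 1 - (2 * j + 1) = j); last lia.
move: ('C(_, _)) ('C(_, _)) => y x H.
rewrite mulnBr mulnA (_ : j.+1 * 2 * x = j * y); last lia.
by rewrite -mulnBl subSnn mul1n.
Qed.

(** A form free of subtraction, from which positivity and the recurrence follow; the 2 comes from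
    2j+2 = 2(j+1). *)
Lemma W_fact (j : nat) : W j * (j`! * (2 * j + 2)`!) = 2 * (3 * j + 1)`!.
Proof.
have E : 2 * j + 1 <= 3 * j + 1 by lia.
rewrite -(bin_fact E) -W_binom (_ : 2 * j + 2 = (2 * j + 1).+1) ?factS; last lia.
rewrite (_ : 3 * j + 1 - (2 * j + 1) = j); last lia.
move: (_ `!) (_ `!) (W j) => a b c; nia.
Qed.

Lemma W_gt0 (j : nat) : 0 < W j.
Proof.
have := W_fact j; have := fact_gt0 (3 * j + 1); case: (W j) => //; lia.
Qed.

(** The predecessor makes the index start at 1; [T 0] is a filler equal to [T 1]. *)
Definition T (k : nat) : nat := 16 ^ k.-1 * W k.-1.

Lemma T_Zpos (k : nat) : (0 < Z.of_nat (T k))%Z.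
Proof. have : 0 < T k by rewrite muln_gt0 expn_gt0 W_gt0. lia. Qed.

Lemma T_rec (j : nat) :
  (j + 2) * (2 * j + 3) * T j.+2 = 24 * (3 * j + 2) * (3 * j + 4) * T j.+1.
Proof.
have H0 := W_fact j; have := W_fact j.+1.
rewrite /T /= expnS.
rewrite (_ : 2 * j.+1 + 2 = (2 * j + 2).+2); last lia.
rewrite (_ : 3 * j.+1 + 1 = (3 * j + 1).+3); last lia.
rewrite !factS.
have : 0 < j`! * (2 * j + 2)`! by rewrite muln_gt0 !fact_gt0.
move: (j`!) ((2 * j + 2)`!) ((3 * j + 1)`!) (W j) (W j.+1) H0 (16 ^ j) => a b c w v.
move=> H0 e ab0 H1.
(* The factor 3j+3 of the new factorial supplies j+1, so [j.+1 * (a * b)] is common to both sides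
   and cancels. *)
have {}H1 : j.+1 * (a * b) * (2 * (j + 2) * (2 * j + 3) * v)
  = j.+1 * (a * b) * (3 * (3 * j + 4) * (3 * j + 2) * w).
  rewrite [RHS](_ : _ = j.+1 * (3 * (3 * j + 4) * (3 * j + 2)) * (w * (a * b))); last lia.
  rewrite H0; lia.
move/eqP: H1; rewrite eqn_pmul2l => [/eqP H1|]; last by rewrite muln_gt0 ab0.
rewrite [LHS](_ : _ = 8 * e * (2 * (j + 2) * (2 * j + 3) * v)); last lia.
rewrite H1; lia.
Qed.

(** Multiplied by (p-2)!, the binomial is a falling factorial with factors 2p + (p-2-i), congruent
    one by one to those of (p-2)!, which is prime to p and cancels. *)
Lemma binom_mod_prime (p : nat) : prime p -> 'C(3 * p - 2, p - 2) = 1 %[mod p].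
Proof.
move=> pp; have p1 := prime_gt1 pp.
have H : 'C(3 * p - 2, p - 2) * (p - 2)`! = 1 * (p - 2)`! %[mod p].
  rewrite mul1n bin_ffact -ffactnn !ffact_prod.
  apply: (big_ind2 (fun a b => a = b %[mod p])) => [//|a b c d ab cd|i _].
    by rewrite -modnMm ab cd modnMm.
  have hi := ltn_ord i.
  by rewrite (_ : 3 * p - 2 - i = 2 * p + (p - 2 - i)) ?modnMDl //; lia.
have cp : coprime p (p - 2)`!.
  rewrite coprime_sym.
  have : p - 2 < p by lia.
  elim: (p - 2) => [|m IH] hm; first by rewrite coprime1n.
  by rewrite factS coprimeMl IH ?andbT ?(ltnW hm) // coprime_sym prime_coprime // gtnNdvd.
move/eqP: H; rewrite eqn_mod_dvd; last first.
  by rewrite leq_mul2r bin_gt0; apply/orP; right; lia.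
rewrite -mulnBl Gauss_dvdl // => H.
by apply/eqP; rewrite eqn_mod_dvd // bin_gt0; lia.
Qed.

Lemma T_mod_prime (p : nat) : prime p -> p %| T p + 2.
Proof.
move=> pp; have p1 := prime_gt1 pp.
have ep : p.-1.+1 = p by lia.
(* The truncated subtraction in [W] can be undone because [W] is positive; symmetry turns C(3p-2,
   2p) into C(3p-2, p-2). *)
have W2 : 'C(3 * p - 2, 2 * p - 1) = W p.-1 + 2 * 'C(3 * p - 2, p - 2).
  have := W_gt0 p.-1; rewrite /W.
  rewrite (_ : 3 * p.-1 + 1 = 3 * p - 2); last lia.
  rewrite (_ : 2 * p.-1 + 1 = 2 * p - 1); last lia.
  rewrite (_ : 2 * p.-1 + 2 = 2 * p); last lia.
  rewrite -(@bin_sub _ (2 * p)); last lia.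
  rewrite (_ : 3 * p - 2 - 2 * p = p - 2); last lia.
  lia.
have W1 := W_binom p.-1; move: W1.
rewrite ep (_ : 3 * p.-1 + 1 = 3 * p - 2); last lia.
rewrite (_ : 2 * p.-1 + 1 = 2 * p - 1); last lia.
rewrite W2 => W1.
have f16 : 16 ^ p.-1 * W p.-1 = W p.-1 %[mod p].
  (* Fermat needs p prime to 16. Otherwise p = 2, where both sides are evaluated. *)
  case: (boolP (p %| 16)) => [|np].
    rewrite (_ : 16 = 2 ^ 4) // Euclid_dvdX // andbT dvdn_prime2 // => /eqP -> //.
  have h1 : 16 ^ p.-1 = 1 %[mod p].
    have := fermat_little 16 pp; rewrite -{1}ep expnS -{3}[16]muln1 => /eqP.
    rewrite eqn_mod_dvd; last by rewrite leq_mul2l expn_gt0.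
    rewrite -mulnBr Gauss_dvdr; last by rewrite prime_coprime.
    by move=> H; apply/eqP; rewrite eqn_mod_dvd // expn_gt0.
  by rewrite -modnMml h1 modnMml mul1n.
rewrite /T /dvdn -modnDml f16 modnDml.
(* Replacing this 1 by the congruent binomial rebuilds the right-hand side of [W2], which is p times
   [W p.-1]. *)
rewrite -[_ + 2]/(W p.-1 + 2 * 1) -modnDmr -modnMmr -(binom_mod_prime _ pp).
by rewrite modnMmr modnDmr -W1 modnMr.
Qed.

Lemma prime_of_Zprime (p : nat) : Znumtheory.prime (Z.of_nat p) -> prime p.
Proof.
move=> pp; apply/primeP; have p1 := prime_ge_2 _ pp; split; first lia.
move=> d /dvdnP [q e].
have : Z.divide (Z.of_nat d) (Z.of_nat p) by exists (Z.of_nat q); lia.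
move/(prime_divisors _ pp); lia.
Qed.

Lemma T_Zmod_prime (p : nat) : Znumtheory.prime (Z.of_nat p) ->
  (Z.of_nat (T p) mod Z.of_nat p = (-2) mod Z.of_nat p)%Z.
Proof.
move=> pp; have p1 := prime_ge_2 _ pp.
move/prime_of_Zprime/T_mod_prime/dvdnP: pp => [q e].
rewrite (_ : Z.of_nat (T p) = (-2 + Z.of_nat q * Z.of_nat p)%Z); last lia.
by rewrite Z_mod_plus_full.
Qed.

End Coefficients.

(** * Uniqueness for the harmonic oscillator *)

Lemma harmonic_zero (al b : R) (u u1 : R -> R) :
  al <> 0 ->
  (forall t, Rabs t < b -> is_derive u t (u1 t)) ->
  (forall t, Rabs t < b -> is_derive u1 t (- al ^ 2 * u t)) ->
  u 0 = 0 -> u1 0 = 0 -> forall t, Rabs t < b -> u t = 0.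
Proof.
  intros Hal Hu Hu1 H0 H10 t Ht.
  (* The energy [E] is constant, and it vanishes at 0. *)
  set (E := fun s => u1 s ^ 2 + al ^ 2 * u s ^ 2).
  assert (HE : forall s, Rabs s < b -> is_derive E s 0).
  { intros s Hs. unfold E. auto_derive.
    - split; [eexists; apply Hu1, Hs | split; [eexists; apply Hu, Hs | exact I]].
    - replace (Derive _ s) with (- al ^ 2 * u s)
        by (symmetry; apply is_derive_unique, Hu1, Hs).
      replace (Derive _ s) with (u1 s)
        by (symmetry; apply is_derive_unique, Hu, Hs).
      ring. }
  assert (H : E t = E 0).
  { apply Rabs_def2 in Ht as [Ht1 Ht2].
    destruct (Rtotal_order t 0) as [h | [h | h]].
    - apply (eq_is_derive E t 0); [| lra].
      intros s Hs. apply HE, Rabs_def1; lra.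
    - now rewrite h.
    - symmetry. apply (eq_is_derive E 0 t); [| lra].
      intros s Hs. apply HE, Rabs_def1; lra. }
  unfold E in H. rewrite H0, H10 in H.
  assert (0 < al ^ 2) by (rewrite <- Rsqr_pow2; now apply Rsqr_pos_lt).
  pose proof (pow2_ge_0 (u1 t)) as h1.
  pose proof (pow2_ge_0 (u t)) as h2.
  apply Rsqr_0_uniq. rewrite Rsqr_pow2. nra.
Qed.

(** * Power series with the Chebyshev recurrence *)

Lemma CV_radius_ge_1 (a : nat -> R) (M : R) :
  (forall n, Rabs (a n) <= M) -> forall y, Rabs y < 1 -> Rbar_lt (Rabs y) (CV_radius a).
Proof.
  intros H y Hy.
  apply Rbar_lt_le_trans with (Finite 1); [exact Hy |].
  apply (CV_radius_bounded a). exists M. intros n.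
  rewrite pow1, Rmult_1_r. apply H.
Qed.

Section Chebyshev_series.

Variables (al : R) (a : nat -> R).
Hypothesis al_pos : 0 < al.
Hypothesis al_le : al <= 1.
Hypothesis a_rec : forall n,
  (INR n + 2) * (INR n + 1) * a (S (S n)) = (INR n ^ 2 - al ^ 2) * a n.

(** Since 0 < al <= 1, |n^2 - al^2| <= (n+2)(n+1), so no coefficient exceeds in size the one two
    places earlier. The induction carries two consecutive terms for that reason. *)
Lemma chebyshev_coef_bounded n : Rabs (a n) <= Rmax (Rabs (a 0%nat)) (Rabs (a 1%nat)).
Proof.
  enough (H : Rabs (a n) <= Rmax (Rabs (a 0%nat)) (Rabs (a 1%nat)) /\
     Rabs (a (S n)) <= Rmax (Rabs (a 0%nat)) (Rabs (a 1%nat))) by apply H.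
  induction n as [| n [IH1 IH2]].
  - split; [apply Rmax_l | apply Rmax_r].
  - split; [exact IH2 |].
    apply Rle_trans with (2 := IH1).
    pose proof (pos_INR n) as Hn.
    assert (Hd : 0 < (INR n + 2) * (INR n + 1)) by nra.
    apply Rmult_le_reg_l with (1 := Hd).
    rewrite <- (Rabs_pos_eq ((INR n + 2) * (INR n + 1))) at 1 by lra.
    rewrite <- Rabs_mult, a_rec, Rabs_mult.
    apply Rmult_le_compat_r; [apply Rabs_pos |].
    apply Rabs_le. nra.
Qed.

Lemma chebyshev_radius y : Rabs y < 1 -> Rbar_lt (Rabs y) (CV_radius a).
Proof. apply CV_radius_ge_1 with (1 := chebyshev_coef_bounded). Qed.

Lemma chebyshev_ode y : Rabs y < 1 ->
  (1 - y ^ 2) * PSeries (PS_derive (PS_derive a)) y - y * PSeries (PS_derive a) y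
  + al ^ 2 * PSeries a y = 0.
Proof.
  intros Hy. pose proof (chebyshev_radius y Hy) as Hr.
  assert (Hr1 : Rbar_lt (Rabs y) (CV_radius (PS_derive a))) by now rewrite CV_radius_derive.
  assert (Hr2 : Rbar_lt (Rabs y) (CV_radius (PS_derive (PS_derive a))))
    by now rewrite !CV_radius_derive.
  set (d2 := PS_derive (PS_derive a)).
  (* Shifting coefficients multiplies by y: [i2] represents y^2 P'' and [i1] represents y P'. *)
  pose (i2 := PS_incr_1 (PS_incr_1 d2)).
  pose (i1 := PS_incr_1 (PS_derive a)).
  assert (E2 : ex_pseries d2 y) by now apply CV_radius_inside.
  assert (E0 : ex_pseries a y) by now apply CV_radius_inside.
  assert (Ei2 : ex_pseries i2 y).
  { apply CV_radius_inside. unfold i2. now rewrite !CV_radius_incr_1. }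
  assert (Ei1 : ex_pseries i1 y).
  { apply CV_radius_inside. unfold i1. now rewrite !CV_radius_incr_1. }
  assert (X : PSeries (PS_plus d2 (PS_plus (PS_scal (-1) i2)
      (PS_plus (PS_scal (-1) i1) (PS_scal (al ^ 2) a)))) y = 0).
  { rewrite <- (PSeries_const_0 y). apply PSeries_ext. intros n.
    unfold PS_plus, PS_scal, i2, i1, d2, PS_derive, PS_incr_1, plus, scal, zero; simpl.
    unfold mult; simpl. pose proof (a_rec n) as H.
    (* The shifts put zeros at the first indices, hence the separate cases 0 and 1. *)
    destruct n as [| [| n]]; try
      change (match n with 0%nat => 1 | S _ => INR n + 1 end) with (INR (S n));
      rewrite ?S_INR in *; simpl INR in *; lra. }
  assert (S0 : ex_pseries (PS_scal (al ^ 2) a) y)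
    by (apply ex_pseries_scal; [apply Rmult_comm | exact E0]).
  assert (S1 : ex_pseries (PS_scal (-1) i1) y)
    by (apply ex_pseries_scal; [apply Rmult_comm | exact Ei1]).
  assert (S2 : ex_pseries (PS_scal (-1) i2) y)
    by (apply ex_pseries_scal; [apply Rmult_comm | exact Ei2]).
  assert (S01 : ex_pseries (PS_plus (PS_scal (-1) i1) (PS_scal (al ^ 2) a)) y)
    by (apply ex_pseries_plus; assumption).
  assert (S012 : ex_pseries
    (PS_plus (PS_scal (-1) i2) (PS_plus (PS_scal (-1) i1) (PS_scal (al ^ 2) a))) y)
    by (apply ex_pseries_plus; assumption).
  rewrite PSeries_plus in X by assumption.
  rewrite PSeries_plus in X by assumption.
  rewrite PSeries_plus in X by assumption.
  rewrite !PSeries_scal in X.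
  unfold i2, i1 in X. rewrite !PSeries_incr_1 in X.
  fold d2. lra.
Qed.

(** The open interval keeps sin t inside the disc of convergence; P(0) = a_0 and P'(0) = a_1
    determine the combination of cosine and sine. *)
Lemma chebyshev_sin t : Rabs t < PI / 2 ->
  PSeries a (sin t) = a 0%nat * cos (al * t) + a 1%nat / al * sin (al * t).
Proof.
  intros Ht.
  assert (Hs : forall s, Rabs s < PI / 2 -> Rabs (sin s) < 1).
  { intros s Hs. apply Rabs_def2 in Hs as [h1 h2].
    assert (0 < cos s) by (apply cos_gt_0; lra).
    pose proof (sin2_cos2 s) as h. unfold Rsqr in h. apply Rabs_def1; nra. }
  apply Rminus_diag_uniq.
  apply (harmonic_zero al (PI / 2)
    (fun s => PSeries a (sin s) - (a 0%nat * cos (al * s) + a 1%nat / al * sin (al * s)))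
    (fun s => PSeries (PS_derive a) (sin s) * cos s
       - (- a 0%nat * al * sin (al * s) + a 1%nat * cos (al * s)))); trivial.
  - lra.
  - intros s Hs0. specialize (Hs s Hs0).
    pose proof (is_derive_PSeries a (sin s) (chebyshev_radius _ Hs)) as D.
    auto_derive.
    + eexists; exact D.
    + replace (Derive _ (sin s)) with (PSeries (PS_derive a) (sin s))
        by (symmetry; apply is_derive_unique, D).
      field. lra.
  - intros s Hs0. specialize (Hs s Hs0).
    assert (Hr1 : Rbar_lt (Rabs (sin s)) (CV_radius (PS_derive a)))
      by (rewrite CV_radius_derive; now apply chebyshev_radius).
    pose proof (is_derive_PSeries _ (sin s) Hr1) as D.
    pose proof (chebyshev_ode (sin s) Hs) as O.
    auto_derive.
    + eexists; exact D.
    + replace (Derive _ (sin s)) with (PSeries (PS_derive (PS_derive a)) (sin s))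
        by (symmetry; apply is_derive_unique, D).
      pose proof (sin2_cos2 s) as h. unfold Rsqr in h.
      (* The leading coefficient 1 - y^2 is the factor cos^2 that the chain rule produces in the
         second derivative. *)
      replace (1 - sin s ^ 2) with (cos s * cos s) in O by lra.
      apply Rminus_diag_uniq. rewrite <- O. field. lra.
  - rewrite Rmult_0_r, sin_0, cos_0, PSeries_0. lra.
  - rewrite Rmult_0_r, sin_0, cos_0, PSeries_0. unfold PS_derive. simpl. lra.
Qed.

End Chebyshev_series.

(** The sequences are interleaved into one Chebyshev sequence. Evaluating its sum at t and at -t,
    where sin^2 agrees, separates the two parities. *)
Lemma even_odd_series (al : R) (u v : nat -> R) :
  0 < al <= 1 ->
  (forall k, (2 * INR k + 1) * (2 * INR k + 2) * u (S k) = ((2 * INR k) ^ 2 - al ^ 2) * u k) ->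
  (forall k, (2 * INR k + 2) * (2 * INR k + 3) * v (S k) = ((2 * INR k + 1) ^ 2 - al ^ 2) * v k) ->
  forall t, Rabs t < PI / 2 ->
  is_series (fun k => u k * sin t ^ (2 * k)) (u 0%nat * cos (al * t)) /\
  is_series (fun k => v k * sin t ^ (2 * k + 1)) (v 0%nat / al * sin (al * t)).
Proof.
  intros [Hal0 Hal1] Hu Hv t Ht.
  set (a := fun n => if Nat.even n then u (Nat.div2 n) else v (Nat.div2 n)).
  assert (aE : forall k, a (2 * k)%nat = u k).
  { intros k. unfold a. now rewrite Nat.even_even, Nat.div2_double. }
  assert (aO : forall k, a (2 * k + 1)%nat = v k).
  { intros k. unfold a. now rewrite Nat.even_odd, Nat.add_1_r, Nat.div2_succ_double. }
  assert (a_rec : forall n,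
    (INR n + 2) * (INR n + 1) * a (S (S n)) = (INR n ^ 2 - al ^ 2) * a n).
  { intros n. destruct (Nat.Even_or_Odd n) as [[k ->] | [k ->]].
    - replace (S (S (2 * k))) with (2 * S k)%nat by lia.
      rewrite !aE, mult_INR. simpl (INR 2). rewrite <- Hu. ring.
    - replace (S (S (2 * k + 1))) with (2 * S k + 1)%nat by lia.
      rewrite !aO, plus_INR, mult_INR. simpl (INR 2). simpl (INR 1). rewrite <- Hv. ring. }
  pose proof (chebyshev_coef_bounded al a Hal0 Hal1 a_rec) as Hb.
  assert (a0 : a 0%nat = u 0%nat) by reflexivity.
  assert (a1 : a 1%nat = v 0%nat) by reflexivity.
  set (M := Rmax (Rabs (a 0%nat)) (Rabs (a 1%nat))) in Hb.
  assert (Hs : Rabs (sin t ^ 2) < 1).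
  { apply Rabs_def2 in Ht as [h1 h2].
    assert (0 < cos t) by (apply cos_gt_0; lra).
    pose proof (sin2_cos2 t) as h. unfold Rsqr in h. apply Rabs_def1; nra. }
  assert (Eu : ex_pseries u (sin t ^ 2)).
  { apply CV_radius_inside, CV_radius_ge_1 with M; trivial. intros n. now rewrite <- aE. }
  assert (Ev : ex_pseries v (sin t ^ 2)).
  { apply CV_radius_inside, CV_radius_ge_1 with M; trivial. intros n. now rewrite <- aO. }
  assert (Split : forall s, s ^ 2 = sin t ^ 2 ->
     PSeries a s = PSeries u (sin t ^ 2) + s * PSeries v (sin t ^ 2)).
  { intros s hs. rewrite PSeries_odd_even; rewrite hs.
    - f_equal; [| f_equal]; apply PSeries_ext; trivial.
    - now apply ex_pseries_ext with (1 := fun n => eq_sym (aE n)).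
    - now apply ex_pseries_ext with (1 := fun n => eq_sym (aO n)). }
  pose proof (chebyshev_sin al a Hal0 Hal1 a_rec t Ht) as P1.
  pose proof (chebyshev_sin al a Hal0 Hal1 a_rec (- t)) as P2.
  rewrite Rabs_Ropp in P2. specialize (P2 Ht).
  rewrite <- Ropp_mult_distr_r, !sin_neg, cos_neg in P2.
  rewrite Split, a0, a1 in P1 by reflexivity.
  rewrite Split, a0, a1 in P2 by ring.
  split.
  - replace (u 0%nat * cos (al * t)) with (PSeries u (sin t ^ 2)) by lra.
    apply is_series_ext with (fun k => u k * (sin t ^ 2) ^ k).
    + intros k. now rewrite pow_mult.
    + now apply is_pseries_R, PSeries_correct.
  - replace (v 0%nat / al * sin (al * t)) with (sin t * PSeries v (sin t ^ 2)) by lra.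
    apply is_series_ext with (fun k => sin t * (v k * (sin t ^ 2) ^ k)).
    + intros k. rewrite pow_add, pow_1, pow_mult. simpl. ring.
    + apply (is_series_scal (K := R_AbsRing) (V := R_NormedModule) (sin t)
        (fun k => v k * (sin t ^ 2) ^ k)).
      now apply is_pseries_R, PSeries_correct.
Qed.

(** * Passage to the endpoint *)

(* The terms being nonnegative, the partial sums at the endpoint are bounded by [G (PI / 2)], and conversely [G] is bounded by the endpoint sum. *)
Lemma series_at_endpoint (c : nat -> R) (e : nat -> nat) (G : R -> R) :
  (forall k, 0 <= c k) -> continuous G (PI / 2) ->
  (forall t, 0 <= t < PI / 2 -> is_series (fun k => c k * sin t ^ e k) (G t)) ->
  is_series c (G (PI / 2)).
Proof.
  intros Hc HG HS.
  pose proof PI_RGT_0 as Hpi.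
  set (s := fun m => PI / 2 - PI / 2 * / (INR m + 1)).
  assert (Hs : forall m, 0 <= s m < PI / 2).
  { intros m. unfold s. pose proof (pos_INR m) as hm.
    assert (0 < / (INR m + 1)) by (apply Rinv_0_lt_compat; lra).
    assert (/ (INR m + 1) <= 1) by (rewrite <- Rinv_1; apply Rinv_le_contravar; lra).
    nra. }
  assert (Ls : is_lim_seq s (PI / 2)).
  { unfold s. replace (Finite (PI / 2)) with (Finite (PI / 2 - PI / 2 * 0)) by (f_equal; ring).
    apply is_lim_seq_minus'; [apply is_lim_seq_const |].
    apply (is_lim_seq_scal_l _ (PI / 2) (Finite 0)).
    replace (Finite 0) with (Rbar_inv p_infty) by reflexivity.
    apply is_lim_seq_inv; [| easy].
    apply is_lim_seq_ext with (fun m => INR (S m)); [intros m; apply S_INR |].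
    apply -> is_lim_seq_incr_1. apply is_lim_seq_INR. }
  assert (Lim : forall F, continuous F (PI / 2) -> is_lim_seq (fun m => F (s m)) (F (PI / 2))).
  { intros F HF. apply is_lim_seq_continuous; trivial. now apply continuity_pt_filterlim. }
  assert (Hsin : forall m, 0 <= sin (s m) <= 1).
  { intros m. destruct (Hs m). split; [apply sin_ge_0; lra | apply SIN_bound]. }
  assert (Hpow : forall m k, 0 <= c k * sin (s m) ^ e k <= c k).
  { intros m k. specialize (Hc k). specialize (Hsin m).
    assert (0 <= sin (s m) ^ e k) by (apply pow_le; lra).
    assert (sin (s m) ^ e k <= 1) by (rewrite <- (pow1 (e k)); apply pow_incr; lra).
    split; [apply Rmult_le_pos; lra | nra]. }
  assert (Hincr : forall a, (forall k, 0 <= a k) -> forall N, sum_n a N <= sum_n a (S N)).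
  { intros a Ha N. rewrite sum_Sn. specialize (Ha (S N)). unfold plus; simpl. lra. }
  assert (Hb : forall N, sum_n c N <= G (PI / 2)).
  { intros N.
    (* For fixed N the finite sum is continuous in t, so its bound by [G] survives the limit t ->
       pi/2. *)
    pose (F := fun t => sum_n (fun k => c k * sin t ^ e k) N).
    assert (HF : continuous F (PI / 2)).
    { unfold F. induction N as [| N IH].
      - apply continuous_ext with (fun t => c 0%nat * sin t ^ e 0%nat).
        + intros t. now rewrite sum_O.
        + apply (ex_derive_continuous (fun t => c 0%nat * sin t ^ e 0%nat)). now auto_derive.
      - apply continuous_ext with
          (fun t => plus (sum_n (fun k => c k * sin t ^ e k) N) (c (S N) * sin t ^ e (S N))).
        + intros t. now rewrite sum_Sn.
        + apply (continuous_plus (V := R_NormedModule)); [exact IH |].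
          apply (ex_derive_continuous (fun t => c (S N) * sin t ^ e (S N))). now auto_derive. }
    assert (HE : F (PI / 2) = sum_n c N).
    { unfold F. apply sum_n_ext. intros k. rewrite sin_PI2, pow1. apply Rmult_1_r. }
    rewrite <- HE.
    apply (is_lim_seq_le (fun m => F (s m)) (fun m => G (s m)) (F (PI / 2)) (G (PI / 2)));
      [| apply Lim; assumption | apply Lim; assumption].
    intros m. unfold F.
    apply is_lim_seq_incr_compare; [exact (HS (s m) (Hs m)) |].
    apply Hincr. intros k. apply Hpow. }
  destruct (ex_finite_lim_seq_incr (sum_n c) (G (PI / 2))) as [l Hl];
    [now apply Hincr | exact Hb |].
  assert (Hl' : is_series c l) by exact Hl.
  replace (G (PI / 2)) with l; [exact Hl' |].
  apply Rle_antisym.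
  - apply (is_lim_seq_le (sum_n c) (fun _ => G (PI / 2)) l (G (PI / 2)));
      [exact Hb | exact Hl | apply is_lim_seq_const].
  - apply (is_lim_seq_le (fun m => G (s m)) (fun _ => l) (G (PI / 2)) l);
      [| apply Lim; assumption | apply is_lim_seq_const].
    intros m.
    rewrite <- (is_series_unique _ _ (HS (s m) (Hs m))), <- (is_series_unique _ _ Hl').
    apply Series_le; [apply Hpow | now exists l].
Qed.

(** * Recurrences of the given coefficients *)

Lemma Sseq_fact (n : nat) :
  Sseq n = INR (fact (6 * n)) * INR (fact n)
    / (2 * (2 * INR n + 1) * INR (fact (3 * n)) * INR (fact (2 * n)) ^ 2).
Proof.
  unfold Sseq, Binomial.C.
  replace (6 * n - 3 * n)%nat with (3 * n)%nat by lia.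
  replace (3 * n - n)%nat with (2 * n)%nat by lia.
  replace (2 * n - n)%nat with n by lia.
  pose proof (pos_INR n).
  field. repeat split; try apply INR_fact_neq_0. lra.
Qed.

(** The odd Chebyshev recurrence for al = 2/3, rescaled by 108 = (6 sqrt 3)^2: indeed (2n+1)^2 - 4/9
    = (6n+1)(6n+5)/9. *)
Lemma Sseq_rec (n : nat) :
  (2 * INR n + 3) * (INR n + 1) * Sseq (S n)
  = 6 * (6 * INR n + 1) * (6 * INR n + 5) * Sseq n.
Proof.
  rewrite !Sseq_fact.
  replace (6 * S n)%nat with (S (S (S (S (S (S (6 * n))))))) by lia.
  replace (3 * S n)%nat with (S (S (S (3 * n)))) by lia.
  replace (2 * S n)%nat with (S (S (2 * n))) by lia.
  rewrite !fact_simpl, !mult_INR, !S_INR, !mult_INR.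
  pose proof (pos_INR n).
  pose proof (INR_fact_neq_0 n). pose proof (INR_fact_neq_0 (2 * n)).
  pose proof (INR_fact_neq_0 (3 * n)). pose proof (INR_fact_neq_0 (6 * n)).
  simpl (INR 6). simpl (INR 3). simpl (INR 2).
  field. repeat split; trivial; lra.
Qed.

Lemma Sseq_0 : Sseq 0 = 1 / 2.
Proof. rewrite Sseq_fact. simpl. field. Qed.

Lemma Sseq_pos (n : nat) : 0 < Sseq n.
Proof.
  rewrite Sseq_fact.
  pose proof (pos_INR n).
  pose proof (INR_fact_lt_0 n). pose proof (INR_fact_lt_0 (2 * n)).
  pose proof (INR_fact_lt_0 (3 * n)). pose proof (INR_fact_lt_0 (6 * n)).
  apply Rdiv_lt_0_compat; repeat apply Rmult_lt_0_compat; try lra.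
Qed.

Lemma T_rec_R (j : nat) :
  (INR j + 2) * (2 * INR j + 3) * INR (Coefficients.T (S (S j)))
  = 24 * (3 * INR j + 2) * (3 * INR j + 4) * INR (Coefficients.T (S j)).
Proof.
  assert (H : ((j + 2) * (2 * j + 3) * Coefficients.T (S (S j))
    = 24 * (3 * j + 2) * (3 * j + 4) * Coefficients.T (S j))%nat)
    (* MathComp's arithmetic on [nat] is convertible to that of the standard library. *)
    by exact (Coefficients.T_rec j).
  apply (f_equal INR) in H.
  rewrite !mult_INR, !plus_INR, !mult_INR, !INR_IZR_INZ in H.
  rewrite !INR_IZR_INZ. exact H.
Qed.

(* [ucoef] and [vcoef] are the coefficients in [y = 6 sqrt 3 x] of [12] times the even and the odd part. *)
Definition ucoef (k : nat) : R :=
  match k with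
  | O => 1 / 2
  | S _ => - 12 * INR (Coefficients.T k) / 108 ^ k
  end.

Definition vcoef (k : nat) : R := 12 * Sseq k / (108 ^ k * (6 * sqrt 3)).

Lemma sqrt3_pos : 0 < sqrt 3.
Proof. apply sqrt_lt_R0. lra. Qed.

Lemma ucoef_rec (k : nat) :
  (2 * INR k + 1) * (2 * INR k + 2) * ucoef (S k)
  = ((2 * INR k) ^ 2 - (2 / 3) ^ 2) * ucoef k.
Proof.
  destruct k as [| j].
  (* This case ties the constant term 1/2 to [T 1]: both sides are -2/9. *)
  - simpl. replace (Coefficients.T 1) with 1%nat by reflexivity. simpl. field.
  - pose proof (T_rec_R j) as H.
    unfold ucoef. rewrite S_INR, <- (tech_pow_Rmult 108 (S j)).
    assert (0 < 108 ^ S j) by (apply pow_lt; lra).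
    set (w := INR (Coefficients.T (S (S j)))) in *.
    set (w0 := INR (Coefficients.T (S j))) in *.
    replace ((2 * (INR j + 1) + 1) * (2 * (INR j + 1) + 2) * (-12 * w / (108 * 108 ^ S j)))
      with (((INR j + 2) * (2 * INR j + 3) * w) * (- 24 / (108 * 108 ^ S j)))
      by (field; lra).
    rewrite H. field. lra.
Qed.

Lemma vcoef_rec (k : nat) :
  (2 * INR k + 2) * (2 * INR k + 3) * vcoef (S k)
  = ((2 * INR k + 1) ^ 2 - (2 / 3) ^ 2) * vcoef k.
Proof.
  pose proof (Sseq_rec k) as H. pose proof sqrt3_pos.
  unfold vcoef. rewrite <- tech_pow_Rmult.
  assert (0 < 108 ^ k) by (apply pow_lt; lra).
  replace ((2 * INR k + 2) * (2 * INR k + 3) * (12 * Sseq (S k) / (108 * 108 ^ k * (6 * sqrt 3))))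
    with (((2 * INR k + 3) * (INR k + 1) * Sseq (S k)) * (24 / (108 * 108 ^ k * (6 * sqrt 3))))
    by (field; lra).
  rewrite H. field. lra.
Qed.

(** The value is sin(pi/3), as the expansion of cos(pi/3 - 2t/3) requires. *)
Lemma vcoef_0 : vcoef 0 / (2 / 3) = sqrt 3 / 2.
Proof.
  pose proof sqrt3_pos as h. unfold vcoef. rewrite Sseq_0.
  apply Rmult_eq_reg_r with (sqrt 3); [| lra].
  replace (sqrt 3 / 2 * sqrt 3) with (sqrt 3 * sqrt 3 / 2) by field.
  rewrite sqrt_sqrt by lra. simpl. field. lra.
Qed.

(** * The two expansions, first inside and then on the closed interval *)

Lemma interior_series (t : R) : Rabs t < PI / 2 ->
  is_series (fun k => vcoef k * sin t ^ (2 * k + 1)) (sqrt 3 / 2 * sin (2 / 3 * t)) /\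
  is_series (fun k => - ucoef (S k) * sin t ^ (2 * (k + 1))) (1 / 2 - cos (2 / 3 * t) / 2).
Proof.
  intros Ht.
  destruct (even_odd_series (2 / 3) ucoef vcoef ltac:(lra) ucoef_rec vcoef_rec t Ht) as [HU HV].
  split.
  - rewrite vcoef_0 in HV. exact HV.
  (* Dropping the constant term and changing sign leaves nonnegative coefficients, as
     [series_at_endpoint] demands. *)
  - apply is_series_opp in HU.
    apply is_series_ext with (fun k => opp (ucoef (S k) * sin t ^ (2 * S k))).
    + intros k. replace (k + 1)%nat with (S k) by lia. unfold opp; simpl. ring.
    + apply (is_series_incr_1 (fun k => opp (ucoef k * sin t ^ (2 * k)))).
      replace (plus _ _) with (opp (ucoef 0 * cos (2 / 3 * t))); [exact HU |].
      unfold plus, opp; simpl. field.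
Qed.

Lemma closed_series (t : R) : - (PI / 2) <= t <= PI / 2 ->
  is_series (fun k => vcoef k * sin t ^ (2 * k + 1)) (sqrt 3 / 2 * sin (2 / 3 * t)) /\
  is_series (fun k => - ucoef (S k) * sin t ^ (2 * (k + 1))) (1 / 2 - cos (2 / 3 * t) / 2).
Proof.
  pose proof PI_RGT_0 as Hpi. pose proof sqrt3_pos as h3.
  assert (HV : is_series vcoef (sqrt 3 / 2 * sin (2 / 3 * (PI / 2)))).
  { apply (series_at_endpoint vcoef (fun k => (2 * k + 1)%nat)
      (fun t => sqrt 3 / 2 * sin (2 / 3 * t))).
    - intros k. apply Rlt_le. unfold vcoef. pose proof (Sseq_pos k).
      assert (0 < 108 ^ k) by (apply pow_lt; lra).
      apply Rdiv_lt_0_compat; [lra | apply Rmult_lt_0_compat; lra].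
    - apply (ex_derive_continuous (fun t => sqrt 3 / 2 * sin (2 / 3 * t))). now auto_derive.
    - intros s Hs. apply interior_series, Rabs_def1; lra. }
  assert (HU : is_series (fun k => - ucoef (S k)) (1 / 2 - cos (2 / 3 * (PI / 2)) / 2)).
  { apply (series_at_endpoint (fun k => - ucoef (S k)) (fun k => (2 * (k + 1))%nat)
      (fun t => 1 / 2 - cos (2 / 3 * t) / 2)).
    - intros k. unfold ucoef. pose proof (pos_INR (Coefficients.T (S k))).
      assert (0 < / 108 ^ S k) by (apply Rinv_0_lt_compat, pow_lt; lra).
      unfold Rdiv. nra.
    - apply (ex_derive_continuous (fun t => 1 / 2 - cos (2 / 3 * t) / 2)). now auto_derive.
    - intros s Hs. apply interior_series, Rabs_def1; lra. }
  intros [[H1 | H1] [H2 | H2]]; [| subst t | subst t | exfalso; lra].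
  - apply interior_series, Rabs_def1; lra.
  - rewrite sin_PI2. split.
    + apply is_series_ext with (2 := HV). intros k. rewrite pow1. symmetry. apply Rmult_1_r.
    + apply is_series_ext with (2 := HU). intros k. rewrite pow1. symmetry. apply Rmult_1_r.
  (* At -pi/2 the odd series changes sign and the even one is unchanged, so both reduce to the
     values at pi/2. *)
  - rewrite sin_neg, sin_PI2, <- Ropp_mult_distr_r, sin_neg, cos_neg. split.
    + replace (sqrt 3 / 2 * - _) with (opp (sqrt 3 / 2 * sin (2 / 3 * (PI / 2))))
        by (unfold opp; simpl; ring).
      apply is_series_ext with (fun k => opp (vcoef k)); [| exact (is_series_opp _ _ HV)].
      intros k. rewrite Nat.add_1_r, pow_1_odd.
      (* The equality is stated in the carrier of a normed module; [ring] needs it in [R]. *)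
      change (@eq R (- vcoef k) (vcoef k * -1)). ring.
    + apply is_series_ext with (2 := HU). intros k. rewrite pow_1_even. symmetry. apply Rmult_1_r.
Qed.

Theorem theorem1p1 :
  exists T : nat -> Z,
    (forall k : nat, (1 <= k)%nat -> (0 < T k)%Z) /\
    (forall x : R, Rabs x <= 1 / (6 * sqrt 3) ->
       ex_series (fun k : nat => Sseq k * x ^ (2 * k + 1)) /\
       ex_series (fun k : nat => IZR (T (k + 1)%nat) * x ^ (2 * (k + 1))) /\
       Series (fun k : nat => Sseq k * x ^ (2 * k + 1)) + 1 / 24
         - Series (fun k : nat => IZR (T (k + 1)%nat) * x ^ (2 * (k + 1)))
       = cos (2 / 3 * acos (6 * sqrt 3 * x)) / 12) /\
    (forall p : nat, prime (Z.of_nat p) ->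
       (T p mod Z.of_nat p = (-2) mod Z.of_nat p)%Z).
Proof.
  exists (fun k => Z.of_nat (Coefficients.T k)). split; [| split].
  - intros k _. apply Coefficients.T_Zpos.
  - intros x Hx.
    pose proof sqrt3_pos as h3.
    assert (h108 : (6 * sqrt 3) ^ 2 = 108).
    { replace ((6 * sqrt 3) ^ 2) with (36 * (sqrt 3 * sqrt 3)) by ring.
      rewrite sqrt_sqrt; lra. }
    assert (Hy : -1 <= 6 * sqrt 3 * x <= 1).
    { apply Rabs_le_between. rewrite Rabs_mult, (Rabs_pos_eq (6 * sqrt 3)) by lra.
      apply Rmult_le_compat_l with (r := 6 * sqrt 3) in Hx; [| lra].
      replace (6 * sqrt 3 * (1 / (6 * sqrt 3))) with 1 in Hx by (field; lra). exact Hx. }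
    rewrite acos_asin by exact Hy.
    pose proof (asin_bound (6 * sqrt 3 * x)) as Ht.
    pose proof (sin_asin _ Hy) as Hsin.
    set (t := asin (6 * sqrt 3 * x)) in *.
    destruct (closed_series t Ht) as [HV HU].
    rewrite Hsin in HV, HU.
    assert (SV : is_series (fun k : nat => Sseq k * x ^ (2 * k + 1))
      (/ 12 * (sqrt 3 / 2 * sin (2 / 3 * t)))).
    { apply is_series_ext with (fun k => / 12 * (vcoef k * (6 * sqrt 3 * x) ^ (2 * k + 1))).
      - intros k. unfold vcoef.
        rewrite Rpow_mult_distr, !pow_add, !pow_1, (pow_mult (6 * sqrt 3)), h108.
        match goal with |- ?l = ?r => change (@eq R l r) end.
        field. split; [lra |]. apply pow_nonzero. lra.
      - now apply (is_series_scal (K := R_AbsRing) (V := R_NormedModule) (/ 12)). }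
    assert (SU : is_series
      (fun k : nat => IZR (Z.of_nat (Coefficients.T (k + 1)%nat)) * x ^ (2 * (k + 1)))
      (/ 12 * (1 / 2 - cos (2 / 3 * t) / 2))).
    { apply is_series_ext
        with (fun k => / 12 * (- ucoef (S k) * (6 * sqrt 3 * x) ^ (2 * (k + 1)))).
      - intros k. unfold ucoef. rewrite <- INR_IZR_INZ, Nat.add_1_r.
        rewrite Rpow_mult_distr, (pow_mult (6 * sqrt 3)), h108.
        match goal with |- ?l = ?r => change (@eq R l r) end.
        field. apply pow_nonzero. lra.
      - now apply (is_series_scal (K := R_AbsRing) (V := R_NormedModule) (/ 12)). }
    split; [now exists (/ 12 * (sqrt 3 / 2 * sin (2 / 3 * t))) |].
    split; [now exists (/ 12 * (1 / 2 - cos (2 / 3 * t) / 2)) |].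
    rewrite (is_series_unique _ _ SV), (is_series_unique _ _ SU).
    (* Here arccos y = pi/2 - t. The even series sums to 1/24 - cos(2t/3)/24, whose constant cancels
       the 1/24 of the statement. *)
    replace (2 / 3 * (PI / 2 - t)) with (PI / 3 - 2 / 3 * t) by field.
    rewrite cos_minus, cos_PI3, sin_PI3. field.
  - exact Coefficients.T_Zmod_prime.
Qed.
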